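(* Let $S$ be a $\Gamma$-hemiring with left unity and right unity, and let $R$ be its right operator hemiring. Then the lattice $\mathrm{Fh\text{-}I}(S)$ of all fuzzy $h$-ideals of $S$ and the lattice $\mathrm{Fh\text{-}I}(R)$ of all fuzzy $h$-ideals of $R$ are isomorphic via the mapping $\sigma\mapsto\sigma^{*'}$, where $\sigma\in\mathrm{Fh\text{-}I}(S)$ and $\sigma^{*'}\in\mathrm{Fh\text{-}I}(R)$.
   Context: **$\Gamma$-hemiring.** Let $S,\Gamma$ be additive commutative semigroups with zero. $S$ is a $\Gamma$-hemiring if there is a map $S\times\Gamma\times S\to S$, $(a,\alpha,b)\mapsto a\alpha b$, such that for all $a,b,c\in S$, $\alpha,\beta\in\Gamma$: $(a+b)\alpha c=a\alpha c+b\alpha c$; $a\alpha(b+c)=a\alpha b+a\alpha c$; $a(\alpha+\beta)b=a\alpha b+a\beta b$; $a\alpha(b\beta c)=(a\alpha b)\beta c$; $0_S\alpha a=0_S=a\alpha 0_S$; $a0_\Gamma b=0_S=b0_\Gamma a$. **Hemiring.** A set $H$ with operations $+,\cdot$ such that $(H,+)$ is a commutative monoid with identity $0$, $(H,\cdot)$ is a semigroup, multiplication distributes over addition from either side, and $0s=0=s0$ for all $s$. **Right operator hemiring $R$.** Let $F$ be the free additive commutative semigroup generated by $\Gamma\times S$; define the congruence $\rho$ on $F$ by $\sum_{i=1}^m(\alpha_i,x_i)\,\rho\,\sum_{j=1}^n(\beta_j,y_j)$ iff $\sum_i a\alpha_ix_i=\sum_j a\beta_jy_j$ for all $a\in S$.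 The class of $\sum_i(\alpha_i,x_i)$ is written $\sum_i[\alpha_i,x_i]$. $R=F/\rho$ with multiplication $(\sum_i[\alpha_i,x_i])(\sum_j[\beta_j,y_j])=\sum_{i,j}[\alpha_i,x_i\beta_jy_j]$ is a hemiring; its zero is $[\gamma,0_S]$ (any $\gamma\in\Gamma$). **Unities.** $S$ has a left unity if there are finitely many $e_i\in S,\delta_i\in\Gamma$ with $\sum_i e_i\delta_i a=a$ for all $a\in S$; it has a right unity if there are finitely many $\gamma_j\in\Gamma,f_j\in S$ with $\sum_j a\gamma_jf_j=a$ for all $a\in S$. **Fuzzy $h$-ideals.** A fuzzy subset of a set $X$ is a function $X\to[0,1]$; it is non-empty if it is not identically $0$. A non-empty fuzzy subset $\mu$ of $S$ is a fuzzy left (right) ideal if $\mu(x+y)\ge\min\{\mu(x),\mu(y)\}$ and $\mu(x\gamma y)\ge\mu(y)$ (resp. $\mu(x\gamma y)\ge\mu(x)$) for all $x,y\in S$, $\gamma\in\Gamma$. It is a fuzzy left (right) $h$-ideal if moreover for all $a,b,x,z\in S$, $x+a+z=b+z$ implies $\mu(x)\ge\min\{\mu(a),\mu(b)\}$. A fuzzy $h$-ideal is one which is both a fuzzy left and a fuzzy right $h$-ideal. The same definitions are used for a hemiring with $xy$ in place of $x\gamma y$. Convention: all fuzzy (left, right) $h$-ideals $\mu$ are assumed to satisfy $\mu(0)=1$. The sets of fuzzy $h$-ideals are ordered by inclusion: $\mu\subseteq\nu$ iff $\mu(x)\le\nu(x)$ for all $x$. **The map.** For a fuzzy subset $\sigma$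 of $S$, $\sigma^{*'}$ is the fuzzy subset of $R$ given by $\sigma^{*'}(\sum_i[\alpha_i,x_i])=\inf_{s\in S}\sigma(\sum_i s\alpha_ix_i)$. *)

(* Defs.v *)
From HB Require Import structures.
From mathcomp Require Import all_boot all_order all_algebra finmap multiset.
From mathcomp Require Import generic_quotient.
From mathcomp Require Import boolp classical_sets reals.
Set Implicit Arguments.
Unset Strict Implicit.
Unset Printing Implicit Defensive.
Import Order.TTheory GRing.Theory Num.Theory.
Local Open Scope classical_set_scope.
Local Open Scope quotient_scope.
Local Open Scope ring_scope.

HB.mixin Record isGammaHemiring (G : nmodType) S of GRing.Nmodule S := {
  gmul : S -> G -> S -> S;
  gmulDl : forall a b al c, gmul (a + b) al c = gmul a al c + gmul b al c;
  gmulDr : forall a al b c, gmul a al (b + c) = gmul a al b + gmul a al c;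
  gmulDm : forall a al be b, gmul a (al + be) b = gmul a al b + gmul a be b;
  gmulA : forall a al b be c, gmul a al (gmul b be c) = gmul (gmul a al b) be c;
  gmul0l : forall al a, gmul 0 al a = 0;
  gmul0r : forall a al, gmul a al 0 = 0;
  gmul0m : forall a b, gmul a 0 b = 0
}.

#[short(type="gammaHemiringType")]
HB.structure Definition GammaHemiring (G : nmodType) :=
  { S of GRing.Nmodule S & isGammaHemiring G S }.

HB.mixin Record isHemiring H of GRing.Nmodule H := {
  hmul : H -> H -> H;
  hmulA : associative hmul;
  hmulDl : left_distributive hmul +%R;
  hmulDr : right_distributive hmul +%R;
  hmul0l : left_zero 0 hmul;
  hmul0r : right_zero 0 hmul
}.

#[short(type="hemiringType")]
HB.structure Definition Hemiring := { H of GRing.Nmodule H & isHemiring H }.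

Definition has_left_unity (G : nmodType) (S : gammaHemiringType G) : Prop :=
  exists (n : nat) (e : 'I_n -> S) (d : 'I_n -> G),
    forall a : S, \sum_(i < n) gmul (e i) (d i) a = a.

Definition has_right_unity (G : nmodType) (S : gammaHemiringType G) : Prop :=
  exists (n : nat) (g : 'I_n -> G) (f : 'I_n -> S),
    forall a : S, \sum_(j < n) gmul a (g j) (f j) = a.

Section RightOperatorHemiring.
Variables (G : nmodType) (S : gammaHemiringType G).

(* The free commutative semigroup on G * S has no empty sum, hence the
   restriction to nonempty multisets. *)
Definition formal_sum : Type := {w : {mset (G * S)%type}%mset | w != mset0%mset}.
HB.instance Definition _ := Choice.on formal_sum.

Implicit Types u v w : formal_sum.

Definition terms w : seq (G * S) := enum_mset (val w).

Lemma terms_neq0 w : terms w != [::].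
Proof. by rewrite -size_eq0 size_mset_eq0; exact: valP w. Qed.

Lemma seq_mset_neq0 (s : seq (G * S)) : s != [::] -> seq_mset s != mset0%mset.
Proof.
apply: contraNneq => s0; have := perm_eq_seq_mset s.
by rewrite s0 enum_mset0 perm_sym => /perm_nilP ->.
Qed.

Definition fsum_of_seq (s : seq (G * S)) (s0 : s != [::]) : formal_sum :=
  exist _ (seq_mset s) (seq_mset_neq0 s0).

Lemma perm_terms s (s0 : s != [::]) : perm_eq (terms (fsum_of_seq s0)) s.
Proof. exact: perm_eq_seq_mset. Qed.

Definition fsum1 (al : G) (x : S) : formal_sum :=
  @fsum_of_seq [:: (al, x)] isT.

Lemma fsum_add_subproof u v : (val u `+` val v != mset0)%mset.
Proof.
have: terms u != [::] := terms_neq0 u.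
case eu: (terms u) => [//|p s] _; apply/eqP => uv0.
have pu : p \in val u by have := mem_head p s; rewrite -eu.
by have := in_msetD (val u) (val v) p; rewrite uv0 pu in_mset0.
Qed.

Definition fsum_add u v : formal_sum :=
  exist _ (val u `+` val v)%mset (fsum_add_subproof u v).

Lemma fsum_mul_subproof u v :
  [seq (p.1, gmul p.2 q.1 q.2) | p <- terms u, q <- terms v] != [::].
Proof.
have := terms_neq0 u; have := terms_neq0 v.
by case: (terms u) => [//|p s]; case: (terms v).
Qed.

Definition fsum_mul u v : formal_sum := fsum_of_seq (fsum_mul_subproof u v).

Definition fsum_act (a : S) w : S := \sum_(p <- terms w) gmul a p.1 p.2.

Definition rho u v : bool := `[< forall a : S, fsum_act a u = fsum_act a v >].

Lemma rho_equiv : equiv_class_of rho.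
Proof.
split=> [u|u v|v u w]; first exact/asboolP.
  by apply/asboolP/asboolP => uv a; rewrite uv.
by move=> /asboolP uv /asboolP vw; apply/asboolP => a; rewrite uv.
Qed.
Canonical rho_equiv_rel := EquivRelPack rho_equiv.

Definition right_operator_hemiring : Type := {eq_quot rho}.
HB.instance Definition _ : EqQuotient formal_sum rho right_operator_hemiring :=
  EqQuotient.on right_operator_hemiring.
HB.instance Definition _ := Choice.on right_operator_hemiring.

Local Notation R := right_operator_hemiring.

(* [rop_act s r] is \sum_i s al_i x_i for r the class of \sum_i (al_i, x_i). *)
Definition rop_act (s : S) (r : R) : S := fsum_act s (repr r).

Lemma rop_act_pi s w : rop_act s (\pi_R w) = fsum_act s w.
Proof.
have /eqquotP /asboolP : repr (\pi_R w) = w %[mod R] by rewrite reprK.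
exact.
Qed.

Lemma rop_act_inj r1 r2 : (forall s, rop_act s r1 = rop_act s r2) -> r1 = r2.
Proof.
by move=> h; rewrite -[r1]reprK -[r2]reprK; apply/eqquotP/asboolP.
Qed.

Definition rop_zero : R := \pi_R (fsum1 0 0).
Definition rop_add (r1 r2 : R) : R := \pi_R (fsum_add (repr r1) (repr r2)).
Definition rop_mul (r1 r2 : R) : R := \pi_R (fsum_mul (repr r1) (repr r2)).

Lemma fsum_act1 s al x : fsum_act s (fsum1 al x) = gmul s al x.
Proof. by rewrite /fsum_act (perm_big _ (perm_terms _)) big_seq1. Qed.

Lemma fsum_actD s u v : fsum_act s (fsum_add u v) = fsum_act s u + fsum_act s v.
Proof.
rewrite /fsum_act -big_cat; apply/perm_big/eq_seq_msetP.
rewrite /terms seq_mset_id; apply/fsfunP => p.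
by rewrite mset_seqE count_cat msetE2 -!mset_seqE !seq_mset_id.
Qed.

Lemma gmul_suml (I : Type) (s : seq I) (F : I -> S) al x :
  gmul (\sum_(i <- s) F i) al x = \sum_(i <- s) gmul (F i) al x.
Proof.
by apply: (big_morph (fun y => gmul y al x)) => [y z|]; [exact: gmulDl|exact: gmul0l].
Qed.

Lemma fsum_actM s u v : fsum_act s (fsum_mul u v) = fsum_act (fsum_act s u) v.
Proof.
rewrite /fsum_act (perm_big _ (perm_terms _)) big_allpairs_dep exchange_big /=.
apply: eq_bigr => q _; rewrite gmul_suml; apply: eq_bigr => p _.
exact: gmulA.
Qed.

Lemma fsum_act0l w : fsum_act 0 w = 0.
Proof. by apply: big1 => p _; rewrite gmul0l. Qed.

Lemma fsum_actDl s t w : fsum_act (s + t) w = fsum_act s w + fsum_act t w.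
Proof. by rewrite -big_split; apply: eq_bigr => p _; rewrite gmulDl. Qed.

Lemma rop_act0 s : rop_act s rop_zero = 0.
Proof. by rewrite rop_act_pi fsum_act1 gmul0r. Qed.

Lemma rop_actD s r1 r2 : rop_act s (rop_add r1 r2) = rop_act s r1 + rop_act s r2.
Proof. by rewrite rop_act_pi fsum_actD. Qed.

Lemma rop_actM s r1 r2 : rop_act s (rop_mul r1 r2) = rop_act (rop_act s r1) r2.
Proof. by rewrite rop_act_pi fsum_actM. Qed.

Lemma rop_act0l r : rop_act 0 r = 0. Proof. exact: fsum_act0l. Qed.

Lemma rop_actDl s t r : rop_act (s + t) r = rop_act s r + rop_act t r.
Proof. exact: fsum_actDl. Qed.

Lemma rop_zeroE al : \pi_R (fsum1 al 0) = rop_zero.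
Proof. by apply: rop_act_inj => s; rewrite rop_act0 rop_act_pi fsum_act1 gmul0r. Qed.

Lemma rop_add_pi u v : rop_add (\pi_R u) (\pi_R v) = \pi_R (fsum_add u v).
Proof.
by apply: rop_act_inj => s; rewrite rop_actD !rop_act_pi fsum_actD.
Qed.

Lemma rop_mul_pi u v : rop_mul (\pi_R u) (\pi_R v) = \pi_R (fsum_mul u v).
Proof.
by apply: rop_act_inj => s; rewrite rop_actM !rop_act_pi fsum_actM.
Qed.

Lemma rop_addA : associative rop_add.
Proof. by move=> x y z; apply: rop_act_inj => s; rewrite !rop_actD addrA. Qed.
Lemma rop_addC : commutative rop_add.
Proof. by move=> x y; apply: rop_act_inj => s; rewrite !rop_actD addrC. Qed.
Lemma rop_add0 : left_id rop_zero rop_add.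
Proof. by move=> x; apply: rop_act_inj => s; rewrite rop_actD rop_act0 add0r. Qed.

HB.instance Definition _ :=
  GRing.isNmodule.Build right_operator_hemiring rop_addA rop_addC rop_add0.

Lemma rop_mulA : associative rop_mul.
Proof. by move=> x y z; apply: rop_act_inj => s; rewrite !rop_actM. Qed.
Lemma rop_mulDl : left_distributive rop_mul +%R.
Proof.
move=> x y z; apply: rop_act_inj => s.
by rewrite [LHS]rop_actM !rop_actD rop_actDl !rop_actM.
Qed.
Lemma rop_mulDr : right_distributive rop_mul +%R.
Proof.
by move=> x y z; apply: rop_act_inj => s; rewrite [LHS]rop_actM !rop_actD !rop_actM.
Qed.
Lemma rop_mul0l : left_zero 0 rop_mul.
Proof. by move=> x; apply: rop_act_inj => s; rewrite rop_actM rop_act0 rop_act0l. Qed.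
Lemma rop_mul0r : right_zero 0 rop_mul.
Proof. by move=> x; apply: rop_act_inj => s; rewrite rop_actM !rop_act0. Qed.

HB.instance Definition _ := isHemiring.Build right_operator_hemiring
  rop_mulA rop_mulDl rop_mulDr rop_mul0l rop_mul0r.

End RightOperatorHemiring.

(* Fuzzy h-ideals with respect to a family of multiplications [op i] on a
   commutative monoid: the family x, y |-> x g y indexed by g for a
   Gamma-hemiring, the single multiplication for a hemiring. *)
Section FuzzyHIdeals.
Variables (K : realType) (I : Type) (X : nmodType) (op : I -> X -> X -> X).
Implicit Types mu nu : X -> K.

Definition fuzzy_subset mu : Prop := forall x, 0 <= mu x <= 1.

Definition fuzzy_nonempty mu : Prop := exists x, mu x != 0.

Definition fuzzy_left_ideal mu : Prop :=
  [/\ fuzzy_subset mu, fuzzy_nonempty mu,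
      forall x y, Num.min (mu x) (mu y) <= mu (x + y)
    & forall i x y, mu y <= mu (op i x y)].

Definition fuzzy_right_ideal mu : Prop :=
  [/\ fuzzy_subset mu, fuzzy_nonempty mu,
      forall x y, Num.min (mu x) (mu y) <= mu (x + y)
    & forall i x y, mu x <= mu (op i x y)].

Definition h_closed mu : Prop :=
  forall a b x z, x + a + z = b + z -> Num.min (mu a) (mu b) <= mu x.

Definition fuzzy_left_h_ideal mu : Prop := fuzzy_left_ideal mu /\ h_closed mu.
Definition fuzzy_right_h_ideal mu : Prop := fuzzy_right_ideal mu /\ h_closed mu.

Definition fuzzy_h_ideal mu : Prop :=
  fuzzy_left_h_ideal mu /\ fuzzy_right_h_ideal mu.

Record fhideal := FHIdeal {
  fhideal_val :> X -> K;
  fhideal_fuzzy : fuzzy_h_ideal fhideal_val;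
  fhideal_at0 : fhideal_val 0 = 1
}.

Implicit Types s t : fhideal.

Lemma fhideal_eq s t : (forall x, s x = t x) -> s = t.
Proof.
case: s t => [s ps s0] [t pt t0] /= /funext st; subst t.
by rewrite (Prop_irrelevance ps pt) (Prop_irrelevance s0 t0).
Qed.

Lemma fhideal_ge0 s x : 0 <= s x.
Proof. by have [[[+ _ _ _] _] _] := fhideal_fuzzy s => /(_ x)/andP[]. Qed.
Lemma fhideal_le1 s x : s x <= 1.
Proof. by have [[[+ _ _ _] _] _] := fhideal_fuzzy s => /(_ x)/andP[]. Qed.
Lemma fhidealD s x y : Num.min (s x) (s y) <= s (x + y).
Proof. by have [[[_ _ + _] _] _] := fhideal_fuzzy s; apply. Qed.
Lemma fhideal_opl s i x y : s y <= s (op i x y).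
Proof. by have [[[_ _ _ +] _] _] := fhideal_fuzzy s; apply. Qed.
Lemma fhideal_opr s i x y : s x <= s (op i x y).
Proof. by have [_ [[_ _ _ +] _]] := fhideal_fuzzy s; apply. Qed.
Lemma fhideal_h s : h_closed s.
Proof. by have [[_ +] _] := fhideal_fuzzy s. Qed.

Lemma fuzzy_h_idealI mu : fuzzy_subset mu -> mu 0 = 1 ->
  (forall x y, Num.min (mu x) (mu y) <= mu (x + y)) ->
  (forall i x y, mu y <= mu (op i x y)) ->
  (forall i x y, mu x <= mu (op i x y)) -> h_closed mu -> fuzzy_h_ideal mu.
Proof.
move=> mu01 mu0 muD mul mur muh.
by split; split=> //; split=> //; exists 0; rewrite mu0 oner_neq0.
Qed.

HB.instance Definition _ := gen_eqMixin fhideal.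
HB.instance Definition _ := gen_choiceMixin fhideal.

Definition fhideal_le s t : bool := `[< forall x, s x <= t x >].

Lemma fhideal_le_refl : reflexive fhideal_le.
Proof. by move=> s; apply/asboolP. Qed.
Lemma fhideal_le_anti : antisymmetric fhideal_le.
Proof.
move=> s t /andP[/asboolP st /asboolP ts]; apply: fhideal_eq => x.
by apply/eqP; rewrite eq_le st ts.
Qed.
Lemma fhideal_le_trans : transitive fhideal_le.
Proof.
move=> t s u /asboolP st /asboolP tu; apply/asboolP => x.
exact: le_trans (st x) (tu x).
Qed.

Fact fhideal_display : Order.disp_t. Proof. exact: (Order.Disp tt tt). Qed.

HB.instance Definition _ := Order.Le_isPOrder.Build fhideal_display fhideal
  fhideal_le_refl fhideal_le_anti fhideal_le_trans.

Lemma fhideal_leP s t : reflect (forall x, s x <= t x) (s <= t)%O.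
Proof. exact: asboolP. Qed.

Definition fhideal_inf_val (P : set fhideal) (x : X) : K :=
  inf [set (t : fhideal) x | t in P].

Lemma fhideal_inf_lb (P : set fhideal) t x : P t -> fhideal_inf_val P x <= t x.
Proof.
move=> Pt; apply: ge_inf; last by exists t.
by exists 0 => _ [u _ <-]; exact: fhideal_ge0.
Qed.

Lemma fhideal_inf_glb (P : set fhideal) x c : P !=set0 ->
  (forall t, P t -> c <= t x) -> c <= fhideal_inf_val P x.
Proof.
move=> [t Pt] h; apply: lb_le_inf; first by exists (t x), t.
by move=> _ [u Pu <-]; exact: h.
Qed.

Lemma fhideal_inf_at0 (P : set fhideal) : P !=set0 -> fhideal_inf_val P 0 = 1.
Proof.
move=> P0; apply/eqP; rewrite eq_le; apply/andP; split.
  by case: (P0) => t Pt; rewrite -(fhideal_at0 t) fhideal_inf_lb.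
by apply: fhideal_inf_glb => // t _; rewrite fhideal_at0.
Qed.

Lemma fhideal_inf_fuzzy (P : set fhideal) : P !=set0 ->
  fuzzy_h_ideal (fhideal_inf_val P).
Proof.
move=> P0; apply: fuzzy_h_idealI; rewrite ?fhideal_inf_at0//.
- move=> x; apply/andP; split.
    by apply: fhideal_inf_glb => // t _; exact: fhideal_ge0.
  by case: (P0) => t Pt; apply: le_trans (fhideal_le1 t x); exact: fhideal_inf_lb.
- move=> x y; apply: fhideal_inf_glb => // t Pt.
  by apply: le_trans (fhidealD t x y); apply: le_min2; exact: fhideal_inf_lb.
- move=> i x y; apply: fhideal_inf_glb => // t Pt.
  by apply: le_trans (fhideal_opl t i x y); exact: fhideal_inf_lb.
- move=> i x y; apply: fhideal_inf_glb => // t Pt.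
  by apply: le_trans (fhideal_opr t i x y); exact: fhideal_inf_lb.
- move=> a b x z e; apply: fhideal_inf_glb => // t Pt.
  by apply: le_trans (fhideal_h t e); apply: le_min2; exact: fhideal_inf_lb.
Qed.

Definition fhideal_inf (P : set fhideal) (P0 : P !=set0) : fhideal :=
  FHIdeal (fhideal_inf_fuzzy P0) (fhideal_inf_at0 P0).

Lemma fhideal_top_fuzzy : fuzzy_h_ideal (fun=> 1 : K).
Proof.
by apply: fuzzy_h_idealI => // [x|x y|a b x z _]; rewrite ?ler01 ?lexx ?minxx.
Qed.

Definition fhideal_top : fhideal := FHIdeal fhideal_top_fuzzy erefl.

Lemma fhideal_meet_nonempty s t : [set s; t] !=set0.
Proof. by exists s; left. Qed.

Lemma fhideal_join_nonempty s t :
  [set u | (s <= u)%O /\ (t <= u)%O] !=set0.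
Proof. by exists fhideal_top; split; apply/fhideal_leP => x; exact: fhideal_le1. Qed.

Definition fhideal_meet s t : fhideal := fhideal_inf (fhideal_meet_nonempty s t).
Definition fhideal_join s t : fhideal := fhideal_inf (fhideal_join_nonempty s t).

Lemma fhideal_meetP u s t : (u <= fhideal_meet s t)%O = (u <= s)%O && (u <= t)%O.
Proof.
apply/fhideal_leP/andP => [h|[/fhideal_leP us /fhideal_leP ut] x].
  by split; apply/fhideal_leP => x; apply: le_trans (h x) _;
    apply: fhideal_inf_lb; [left|right].
by apply: fhideal_inf_glb; [exact: fhideal_meet_nonempty|move=> v [->|->]].
Qed.

Lemma fhideal_joinP s t u : (fhideal_join s t <= u)%O = (s <= u)%O && (t <= u)%O.
Proof.
apply/fhideal_leP/andP => [h|[su tu] x]; last exact: fhideal_inf_lb.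
by split; apply/fhideal_leP => x; apply: le_trans (h x);
  (apply: fhideal_inf_glb; first exact: fhideal_join_nonempty) =>
  v [/fhideal_leP sv /fhideal_leP tv].
Qed.

HB.instance Definition _ := Order.POrder_MeetJoin_isLattice.Build
  fhideal_display fhideal fhideal_meetP fhideal_joinP.

End FuzzyHIdeals.

Definition FhI_gamma (K : realType) (G : nmodType) (S : gammaHemiringType G) :=
  fhideal K (fun (g : G) (x y : S) => gmul x g y).

Definition FhI_hemiring (K : realType) (H : hemiringType) :=
  fhideal K (fun (_ : unit) (x y : H) => hmul x y).

HB.instance Definition _ (K : realType) (G : nmodType) (S : gammaHemiringType G) :=
  Order.Lattice.on (FhI_gamma K S).
HB.instance Definition _ (K : realType) (H : hemiringType) :=
  Order.Lattice.on (FhI_hemiring K H).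

Definition sigma_star (K : realType) (G : nmodType) (S : gammaHemiringType G)
    (sigma : S -> K) (r : right_operator_hemiring S) : K :=
  inf [set sigma (rop_act s r) | s in [set: S]].

(* Main.v *)
Require Import Defs.
From HB Require Import structures.
From mathcomp Require Import all_boot all_order all_algebra reals.
From mathcomp Require Import generic_quotient boolp classical_sets.
Import Order.Theory.
Import GRing.Theory.
Local Open Scope classical_set_scope.
Local Open Scope quotient_scope.
Local Open Scope ring_scope.

(** The inverse of [sigma |-> sigma^{*'}] sends [mu] to
    [mu^+ x = inf_g mu [g, x]]. Writing [x = \sum_i e_i d_i x] gives
    [sigma x >= min_i sigma (e_i d_i x) >= (sigma^{*'})^+ x], and writing
    [r = \sum_j [g_j, f_j r]] gives [mu r >= (mu^+)^{*'} r]; the reverse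
    inequalities hold because [sigma] and [mu] are ideals. Both maps are
    monotone, so this bijection is an order isomorphism and hence preserves
    meets and joins. *)

(** * Order isomorphisms between lattices *)

Section OrderIsomorphism.
Context {d d' : Order.disp_t} {T : latticeType d} {T' : latticeType d'}.
Variables (f : T -> T') (g : T' -> T).
Hypotheses (fK : cancel f g) (gK : cancel g f).
Hypotheses (fle : {homo f : x y / (x <= y)%O}) (gle : {homo g : x y / (x <= y)%O}).

(** This makes [f] left adjoint to [g], hence compatible with joins; [order_iso_inv_le] makes it
    right adjoint as well, hence compatible with meets. *)
Lemma order_iso_le_inv x y : (f x <= y)%O = (x <= g y)%O.
Proof. by apply/idP/idP => [/gle|/fle]; rewrite ?fK ?gK. Qed.

Lemma order_iso_inv_le x y : (g x <= y)%O = (x <= f y)%O.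
Proof. by apply/idP/idP => [/fle|/gle]; rewrite ?fK ?gK. Qed.

Lemma order_iso_meet : {morph f : x y / Order.meet x y}.
Proof.
move=> x y; apply/le_anti; rewrite lexI !fle ?leIl ?leIr //=.
by rewrite -order_iso_inv_le lexI !order_iso_inv_le leIl leIr.
Qed.

Lemma order_iso_join : {morph f : x y / Order.join x y}.
Proof.
move=> x y; apply/le_anti; rewrite leUx !fle ?leUl ?leUr //= andbT.
by rewrite order_iso_le_inv leUx -!order_iso_le_inv leUl leUr.
Qed.

Lemma order_iso_lmorphism : exists h : {lmorphism T -> T'}, h =1 f.
Proof.
pose m1 := Order.isOrderMorphism.Build _ _ _ _ f fle.
pose m2 := Order.isMeetLatticeMorphism.Build _ _ _ _ f order_iso_meet.
pose m3 := Order.isJoinLatticeMorphism.Build _ _ _ _ f order_iso_join.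
pose h : {lmorphism T -> T'} := HB.pack f m1 m2 m3.
by exists h.
Qed.

End OrderIsomorphism.

(** * Finite sums and infima of pullbacks of fuzzy h-ideals *)

Section FuzzyHIdealTheory.
Context {K : realType} {I : Type} {X : nmodType} {op : I -> X -> X -> X}.
Variable s : fhideal K op.

(** The bound [c <= 1] covers the empty sum, where [s 0 = 1]. *)
Lemma fhideal_sum n (F : 'I_n -> X) (c : K) :
  c <= 1 -> (forall i, c <= s (F i)) -> c <= s (\sum_(i < n) F i).
Proof.
move=> c1 cF; elim/big_ind: _ => [|x y cx cy|i _]; last exact: cF.
- by rewrite fhideal_at0.
- by apply: le_trans (fhidealD s x y); rewrite le_min cx.
Qed.

End FuzzyHIdealTheory.

Section InfimumPullback.
Context {K : realType} {I J T : Type} {X Y : nmodType}.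
Context {opX : I -> X -> X -> X} {opY : J -> Y -> Y -> Y}.
Variables (s : fhideal K opY) (phi : T -> X -> Y).

(** Common form of both maps: [phi] is [rop_act] for sigma^{*'} and [rop_gen] for mu^+. *)
Definition inf_pullback (x : X) : K := inf [set s (phi t x) | t in [set: T]].

Lemma inf_pullback_le t x : inf_pullback x <= s (phi t x).
Proof.
apply: ge_inf; last by exists t.
by exists 0 => _ [u _ <-]; exact: fhideal_ge0.
Qed.

Variable t0 : T.

(** The index [t0] keeps the set of values non-empty; the infimum of the empty set is 0 by
    default. *)
Lemma le_inf_pullback x c : (forall t, c <= s (phi t x)) -> c <= inf_pullback x.
Proof.
move=> cs; apply: lb_le_inf; first by exists (s (phi t0 x)), t0.
by move=> _ [u _ <-].
Qed.

Hypotheses (phi0 : forall t, phi t 0 = 0)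
  (phiD : forall t x y, phi t (x + y) = phi t x + phi t y).

Lemma inf_pullback_at0 : inf_pullback 0 = 1.
Proof.
apply/le_anti/andP; split; last first.
  by apply: le_inf_pullback => t; rewrite phi0 fhideal_at0.
by apply: le_trans (inf_pullback_le t0 0) _; exact: fhideal_le1.
Qed.

(** Additivity of each [phi t] gives the sum and h-closure conditions. Absorption may change the
    index [t], so it is left to each instance. *)
Lemma inf_pullback_fuzzy :
  (forall i x y t, inf_pullback y <= s (phi t (opX i x y))) ->
  (forall i x y t, inf_pullback x <= s (phi t (opX i x y))) ->
  fuzzy_h_ideal opX inf_pullback.
Proof.
move=> opl opr; apply: fuzzy_h_idealI.
- move=> x; apply/andP; split.
    by apply: le_inf_pullback => t; exact: fhideal_ge0.
  by apply: le_trans (inf_pullback_le t0 x) _; exact: fhideal_le1.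
- exact: inf_pullback_at0.
- move=> x y; apply: le_inf_pullback => t; rewrite phiD.
  by apply: le_trans (fhidealD s _ _); apply: le_min2; exact: inf_pullback_le.
- by move=> i x y; apply: le_inf_pullback.
- by move=> i x y; apply: le_inf_pullback.
- move=> a b x z e; apply: le_inf_pullback => t.
  have := congr1 (phi t) e; rewrite !phiD => /(fhideal_h s).
  by apply: le_trans; apply: le_min2; exact: inf_pullback_le.
Qed.

End InfimumPullback.

(** * Generators [g, x] of R and the right action of R on S *)

Section RightOperatorHemiringTheory.
Context {G : nmodType} {S : gammaHemiringType G}.
Local Notation R := (right_operator_hemiring S).
Implicit Types (r : R) (s x y : S) (g : G).

Definition rop_gen g x : R := \pi_R (fsum1 g x).

Lemma rop_act_gen s g x : rop_act s (rop_gen g x) = gmul s g x.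
Proof. by rewrite rop_act_pi fsum_act1. Qed.

Lemma rop_act_add s r1 r2 : rop_act s (r1 + r2) = rop_act s r1 + rop_act s r2.
Proof. exact: rop_actD. Qed.

Lemma rop_act_zero s : rop_act s (0 : R) = 0.
Proof. exact: rop_act0. Qed.

Lemma rop_act_mul s r1 r2 :
  rop_act s (hmul r1 r2) = rop_act (rop_act s r1) r2.
Proof. exact: rop_actM. Qed.

Lemma rop_act_sum s n (F : 'I_n -> R) :
  rop_act s (\sum_(i < n) F i) = \sum_(i < n) rop_act s (F i).
Proof. by apply: big_morph; [exact: rop_act_add | exact: rop_act_zero]. Qed.

Lemma gmul_act s g x r : gmul s g (rop_act x r) = rop_act (gmul s g x) r.
Proof.
rewrite /rop_act /fsum_act; elim/big_rec2: _ => [|p y z _ <-].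
  by rewrite gmul0r.
by rewrite gmulDr gmulA.
Qed.

Lemma rop_gen0 g : rop_gen g 0 = 0.
Proof. exact: rop_zeroE. Qed.

Lemma rop_genD g x y : rop_gen g (x + y) = rop_gen g x + rop_gen g y.
Proof.
by apply: rop_act_inj => s; rewrite rop_act_add !rop_act_gen gmulDr.
Qed.

Lemma rop_gen_act g x r : rop_gen g (rop_act x r) = hmul (rop_gen g x) r.
Proof.
by apply: rop_act_inj => s; rewrite rop_act_mul !rop_act_gen gmul_act.
Qed.

Lemma rop_gen_gmul g x h y :
  rop_gen g (gmul x h y) = hmul (rop_gen g x) (rop_gen h y).
Proof. by rewrite -rop_gen_act rop_act_gen. Qed.

(** The element \sum_j [g_j, f_j] acts on S as the identity, so multiplying [r] by it on the left
    gives back [r]. *)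
Lemma right_unity_decomp n (g : 'I_n -> G) (f : 'I_n -> S) r :
  (forall a, \sum_(j < n) gmul a (g j) (f j) = a) ->
  r = \sum_(j < n) rop_gen (g j) (rop_act (f j) r).
Proof.
move=> gf; apply: rop_act_inj => s; rewrite rop_act_sum -{1}(gf s).
rewrite (big_morph (fun a => rop_act a r) (id1 := 0) (op1 := +%R)).
- by apply: eq_bigr => j _; rewrite rop_act_gen gmul_act.
- by move=> a b; exact: rop_actDl.
- exact: rop_act0l.
Qed.

End RightOperatorHemiringTheory.

(** * The two mutually inverse maps *)

Section Correspondence.
Context {K : realType} {G : nmodType} {S : gammaHemiringType G}.
Local Notation R := (right_operator_hemiring S).
Implicit Types (sigma tau : FhI_gamma K S) (mu nu : FhI_hemiring K R).

(** Every term x al_i x_i of the sum has value at least [sigma x] by right absorption. *)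
Lemma fhideal_rop_act sigma x (r : R) : sigma x <= sigma (rop_act x r).
Proof.
rewrite /rop_act /fsum_act; elim/big_ind: _ => [|y z xy xz|p _].
- by rewrite fhideal_at0 fhideal_le1.
- by apply: le_trans (fhidealD sigma y z); rewrite le_min xy.
- exact: (fhideal_opr sigma).
Qed.

Definition star_fun sigma : R -> K := inf_pullback sigma (fun s r => rop_act s r).

Lemma star_fuzzy sigma :
  fuzzy_h_ideal (fun (_ : unit) (x y : R) => hmul x y) (star_fun sigma).
Proof.
apply: (inf_pullback_fuzzy sigma _ (0 : S)) => [||_ x y t|_ x y t].
- exact: rop_act_zero.
- exact: rop_act_add.
(* Since t(xy) = (tx)y, the infimum for [y] is bounded by its value at the index [rop_act t x]. *)
- by rewrite rop_act_mul; exact: inf_pullback_le.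
- rewrite rop_act_mul; apply: le_trans (fhideal_rop_act _ _ _).
  exact: inf_pullback_le.
Qed.

Lemma star_at0 sigma : star_fun sigma 0 = 1.
Proof. by apply: (inf_pullback_at0 sigma _ (0 : S)); exact: rop_act_zero. Qed.

Definition star sigma : FhI_hemiring K R :=
  FHIdeal (star_fuzzy sigma) (star_at0 sigma).

Definition plus_fun mu : S -> K := inf_pullback mu (fun g x => rop_gen g x).

Lemma plus_fuzzy mu :
  fuzzy_h_ideal (fun (g : G) (x y : S) => gmul x g y) (plus_fun mu).
Proof.
apply: (inf_pullback_fuzzy mu _ (0 : G)) => [||h x y g|h x y g].
- exact: rop_gen0.
- exact: rop_genD.
(* As [g, x h y] = [g, x][h, y], absorption in R applies; the index is [h] here and [g] in the
   right-hand case. *)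
- rewrite rop_gen_gmul; apply: le_trans (fhideal_opl mu tt _ _).
  exact: inf_pullback_le.
- rewrite rop_gen_gmul; apply: le_trans (fhideal_opr mu tt _ _).
  exact: inf_pullback_le.
Qed.

Lemma plus_at0 mu : plus_fun mu 0 = 1.
Proof. by apply: (inf_pullback_at0 mu _ (0 : G)); exact: rop_gen0. Qed.

Definition plus mu : FhI_gamma K S := FHIdeal (plus_fuzzy mu) (plus_at0 mu).

Lemma starK : has_left_unity S -> cancel star plus.
Proof.
move=> [n [e [d ed]]] sigma; apply: fhideal_eq => x.
apply/le_anti/andP; split.
  rewrite -[X in _ <= sigma X](ed x).
  apply: fhideal_sum => [|i]; first exact: fhideal_le1.
  (* The outer infimum is taken at [d i], the inner one at [e i]. *)
  apply: le_trans (inf_pullback_le (star sigma) _ (d i) x) _.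
  by rewrite -rop_act_gen; exact: inf_pullback_le.
apply: (le_inf_pullback _ _ 0) => g; apply: (le_inf_pullback _ _ 0) => s.
by rewrite rop_act_gen; exact: (fhideal_opl sigma).
Qed.

Lemma plusK : has_right_unity S -> cancel plus star.
Proof.
move=> [n [g [f gf]]] mu; apply: fhideal_eq => r.
apply/le_anti/andP; split.
  rewrite [X in _ <= mu X](right_unity_decomp _ _ _ r gf).
  apply: fhideal_sum => [|j]; first exact: fhideal_le1.
  (* The outer infimum is taken at [f j], the inner one at [g j]. *)
  apply: le_trans (inf_pullback_le (plus mu) _ (f j) r) _.
  exact: inf_pullback_le.
(* Here [h, s r] = [h, s] r, so left absorption of [mu] suffices. *)
apply: (le_inf_pullback _ _ 0) => s; apply: (le_inf_pullback _ _ 0) => h.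
by rewrite rop_gen_act; exact: (fhideal_opl mu tt).
Qed.

Lemma star_homo : {homo star : sigma tau / (sigma <= tau)%O}.
Proof.
move=> sigma tau /fhideal_leP st; apply/fhideal_leP => r.
apply: (le_inf_pullback _ _ 0) => s; apply: le_trans (st _).
exact: inf_pullback_le.
Qed.

Lemma plus_homo : {homo plus : mu nu / (mu <= nu)%O}.
Proof.
move=> mu nu /fhideal_leP mn; apply/fhideal_leP => x.
apply: (le_inf_pullback _ _ 0) => g; apply: le_trans (mn _).
exact: inf_pullback_le.
Qed.

End Correspondence.

Theorem theorem3p9 (K : realType) (G : nmodType) (S : gammaHemiringType G)
    (hl : has_left_unity S) (hr : has_right_unity S) :
  exists f : {lmorphism FhI_gamma K S
                 -> FhI_hemiring K (right_operator_hemiring S)},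
    bijective f /\
    forall (sigma : FhI_gamma K S) (r : right_operator_hemiring S),
      f sigma r = sigma_star sigma r.
Proof.
have [f fE] := order_iso_lmorphism _ _ (starK (K := K) hl) (plusK hr)
  star_homo plus_homo.
(* [star sigma r] unfolds to [sigma_star sigma r]. *)
exists f; split=> [|sigma r]; last by rewrite fE.
exists plus => [sigma|mu]; first by rewrite fE (starK hl).
by rewrite fE (plusK hr).
Qed.
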